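(* Let $1\le p\le\infty$ and let $X=\ell_p(\mathbb{N})$. There exists an unbounded linear functional $h:X\to\mathbb{R}$ such that for every disjoint family of elements of $X$, all elements of this family, except possibly one, lie in $\ker h$.
   Context: $\ell_p(\mathbb{N})$ is the usual Banach lattice of real sequences $x=(x_n)_{n\in\mathbb{N}}$ that are $p$-summable (bounded, if $p=\infty$), with its usual norm. The support of $x$ is $\mathrm{supp}(x)=\{n\in\mathbb{N}: x_n\neq 0\}$. A subset $A\subset X$ is called a disjoint family if its elements have pairwise disjoint supports, i.e. $\mathrm{supp}(a)\cap\mathrm{supp}(b)=\emptyset$ for all distinct $a,b\in A$. A linear functional is unbounded if it is not bounded (equivalently, not continuous) with respect to the norm of $X$. *)

(* Defs.v *)
From HB Require Import structures.
From mathcomp Require Import all_boot all_order all_algebra.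
From mathcomp Require Import all_classical all_reals all_analysis.

Set Implicit Arguments.
Unset Strict Implicit.
Unset Printing Implicit Defensive.

Import Order.TTheory GRing.Theory Num.Theory.
Import numFieldNormedType.Exports.

Local Open Scope classical_set_scope.
Local Open Scope ring_scope.

(* Every sequence is measurable for the discrete sigma-algebra of nat, and only
   the empty set is negligible for the counting measure, so that LfunType
   consists exactly of the p-summable (bounded, if p = +oo) sequences and no
   quotient by almost-everywhere equality is needed; see in_ellP and ellnormP
   for p finite and in_ellyP and ellnormyP for p = +oo. *)
Notation ell p1 := (LfunType (@counting nat _) p1).

Definition ellnorm (R : realType) (p : \bar R) (p1 : (1 <= p)%E)
    (x : ell p1) : R :=
  fine 'N[@counting nat R]_p[EFin \o x]%E.

Definition supp (R : realType) (p : \bar R) (p1 : (1 <= p)%E)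
    (x : ell p1) : set nat := [set n | x n != 0].

Definition disjoint_family (R : realType) (p : \bar R) (p1 : (1 <= p)%E)
    (A : set (ell p1)) : Prop := trivIset A (@supp R p p1).

Definition bounded_functional (R : realType) (p : \bar R) (p1 : (1 <= p)%E)
    (h : ell p1 -> R) : Prop :=
  exists M : R, forall x : ell p1, `|h x| <= M * ellnorm x.

Section ell_characterization.
Context (R : realType).
Implicit Types (u : nat -> R).

Lemma nat_mfun u : u \in @mfun _ _ nat R.
Proof. by rewrite inE. Qed.

Lemma counting_ae (P : nat -> Prop) :
  (\forall n \ae (@counting nat R), P n) <-> forall n, P n.
Proof.
split=> [[N [_ N0 PN]] n|PT]; last exact/nearW.
apply: contrapT => /PN Nn; move: N0; rewrite /counting.
case: asboolP => // finN [] /eqP.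
rewrite pnatr_eq0 finmap.cardfs_eq0 => /eqP N0.
by have := in_fset_set finN n; rewrite N0 inE => /esym/negP; apply; rewrite inE.
Qed.

Lemma ellnormP (r : R) (r1 : (1 <= r%:E)%E) (x : ell r1) :
  ((ellnorm x)%:E =
   (\sum_(0 <= n <oo) (`|x n| `^ r)%:E) `^ r^-1)%E.
Proof.
rewrite /ellnorm finite_norm_fine Lnorm_counting//.
by rewrite -lte_fin (lt_le_trans _ r1).
Qed.

Lemma in_ellP (r : R) (r1 : (1 <= r%:E)%E) u :
  (exists x : ell r1, u = x :> (nat -> R)) <->
  (\sum_(0 <= n <oo) (`|u n| `^ r)%:E < +oo)%E.
Proof.
have r0 : 0 < r by rewrite -lte_fin (lt_le_trans _ r1).
have E : ('N[@counting nat R]_r%:E[EFin \o u] =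
    (\sum_(0 <= n <oo) (`|u n| `^ r)%:E) `^ r^-1)%E by rewrite Lnorm_counting.
have s0 : (0 <= \sum_(0 <= n <oo) (`|u n| `^ r)%:E)%E.
  by apply: nneseries_ge0 => n _ _; rewrite lee_fin powR_ge0.
split=> [[x ux]|fu].
  have := @Lfunction_finite _ _ _ _ _ r1 x; rewrite /finite_norm -ux E => /lty_poweRy; apply.
  by rewrite invr_neq0// gt_eqF.
have fN : u \in Lfun (@counting nat R) r%:E.
  rewrite inE/= nat_mfun/= inE/= /finite_norm E.
  exact: poweR_lty.
by exists (Lfun_Sub r1 fN).
Qed.

Lemma Lnorm_countingy u : ('N[@counting nat R]_+oo[EFin \o u] =
  ereal_sup (range (fun n => `|u n|%:E)))%E.
Proof.
have c0 : (0 < @counting nat R [set: nat])%E.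
  rewrite /counting; case: asboolP => [/infinite_nat//|_]; exact: lt0y.
rewrite unlock /Lnorm c0; apply/eqP; rewrite eq_le; apply/andP; split.
  apply: ereal_inf_lbound => /=; apply/counting_ae => n /=.
  by apply: ereal_sup_ubound; exists n.
apply: le_ereal_inf_tmp => y /= /counting_ae yu.
by apply: ge_ereal_sup => _ [n _ <-]; exact: yu.
Qed.

Lemma ellnormyP (y1 : (1 <= +oo :> \bar R)%E) (x : ell y1) :
  ((ellnorm x)%:E = ereal_sup (range (fun n => `|x n|%:E)))%E.
Proof. by rewrite /ellnorm finite_norm_fine Lnorm_countingy. Qed.

Lemma in_ellyP (y1 : (1 <= +oo :> \bar R)%E) u :
  (exists x : ell y1, u = x :> (nat -> R)) <->
  exists M : R, forall n, `|u n| <= M.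
Proof.
split=> [[x ux]|[M uM]].
  exists (ellnorm x) => n; rewrite -lee_fin ellnormyP ux.
  by apply: ereal_sup_ubound; exists n.
have fN : u \in Lfun (@counting nat R) +oo%E.
  rewrite inE/= nat_mfun/= inE/= /finite_norm Lnorm_countingy.
  apply: (@le_lt_trans _ _ M%:E); last exact: ltry.
  by apply: ge_ereal_sup => _ [n _ <-]; rewrite lee_fin.
by exists (Lfun_Sub y1 fN).
Qed.

End ell_characterization.

(* Main.v *)
From HB Require Import structures.
Require Import Defs.
From mathcomp Require Import all_boot all_order all_algebra.
From mathcomp Require Import all_classical all_reals all_analysis.

(** The functional lives on an ultrapower. Fix a free ultrafilter U on the
    natural numbers; the sequences vanishing U-almost everywhere form a
    subspace Z of ell_p ([subspace_null]). Two disjoint subsets of nat cannot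
    both belong to U, so among elements with pairwise disjoint supports at most
    one lies outside Z: any linear functional h that is zero on Z kills all
    members of a disjoint family but one.

    It remains to find an unbounded such h. Take w with all its terms nonzero
    and decreasing fast enough that its tails can be multiplied by factors
    tending to infinity and stay bounded in norm: with v_n = 2^-(n+1) and
    w = v^2, the tail of w from m on, multiplied by 2^(m+1), is dominated by v.
    As w is not in Z, Zorn's lemma ([separating_functional]) gives h with
    h(w) = 1 and h = 0 on Z. Since U is free, Z contains all finitely supported
    sequences, so h takes the value 1 on every tail of w, hence 2^(m+1) on a
    vector of norm at most that of v ([unbounded_functional]). The norm
    estimate needs only that v is in ell_p and that the norm is monotone for
    pointwise domination ([ell_dominated]), so it is the same for all
    exponents. For p = +oo finitely supported sequences are not dense, and a
    nonzero functional vanishing on them may well be bounded; choosing h(w) = 1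
    at a sequence w tending to 0 is what excludes this. *)

Set Implicit Arguments.
Unset Strict Implicit.
Unset Printing Implicit Defensive.

Import Order.TTheory GRing.Theory Num.Theory.

Local Open Scope classical_set_scope.
Local Open Scope ring_scope.

Section separation.
Context (K : fieldType) (V : lmodType K).
Implicit Types (S M : set V).

Definition subspace S :=
  S 0 /\ forall (a : K) x y, S x -> S y -> S (a *: x + y).

Lemma subspaceZ S a x : subspace S -> S x -> S (a *: x).
Proof. by move=> [S0 SL] Sx; rewrite -[_ *: _]addr0; exact: SL. Qed.

(** Take M maximal among the subspaces containing S but not w: if x is outside
    M, then M + K x must contain w. *)
Lemma maximal_subspace_avoiding S w : subspace S -> ~ S w ->
  exists M, [/\ subspace M, S `<=` M, ~ M w &
    forall x, ~ M x -> exists a, M (w - a *: x)].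
Proof.
move=> [S0 SL] Sw.
(* Ordering the sets X through S `|` X, rather than the subspaces containing S,
   makes the empty chain, whose union is empty, an admissible one. *)
pose P : set (set V) := [set X | subspace (S `|` X) /\ ~ (S `|` X) w].
have [|A [[sA Aw] Amax]] := @Zorn_bigcup V P.
  move=> F FP Ftot; split; last first.
    move=> [//|[X FX Xw]]; have [_] := FP X FX; apply; by right.
  split=> [|a x y]; first by left.
  have FL X : F X -> (S `|` X) x -> (S `|` X) y ->
      (S `|` \bigcup_(X in F) X) (a *: x + y).
    move=> FX Xx Xy; have [[_ XL] _] := FP X FX.
    by have [?|?] := XL a x y Xx Xy; [left|right; exists X].
  move=> [Sx|[X FX Xx]] [Sy|[Y FY Yy]].
  - by left; exact: SL.
  - by apply: (FL Y FY) => //; [left|right].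
  - by apply: (FL X FX) => //; [right|left].
  - have [XY|YX] := Ftot _ _ FX FY.
    + by apply: (FL Y FY); right=> //; exact: XY.
    + by apply: (FL X FX); right=> //; exact: YX.
exists (S `|` A); split=> // x Mx.
pose B : set V := [set y | exists a, (S `|` A) (y - a *: x)].
have MB : S `|` A `<=` B by move=> y My; exists 0; rewrite scale0r subr0.
have SBE : S `|` B = B.
  by apply/setUidPr => y Sy; apply: MB; left.
have AB : A `<` B.
  split=> [y Ay|BA]; first by apply: MB; right.
  apply: Mx; right; apply: BA; exists 1; rewrite scale1r subrr; exact: sA.1.
have PB : ~ (subspace B /\ ~ B w) by rewrite -SBE; exact: Amax.
apply: contrapT => Bw; apply: PB; split=> //.
split; first by apply: MB; left.
move=> c y z [a Ma] [b Mb]; exists (c * a + b).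
rewrite scalerDl -scalerA opprD addrACA -scalerBr.
exact: sA.2.
Qed.

(** The subspace M of [maximal_subspace_avoiding] has the line K w as a
    complement, and h is the coordinate along w. *)
Lemma separating_functional S w : subspace S -> ~ S w ->
  exists h : {scalar V}, h w = 1 /\ forall x, S x -> h x = 0.
Proof.
move=> sS /(maximal_subspace_avoiding sS)[M [sM SM Mw Mmax]].
have ex x : {c | M (x - c *: w)}.
  apply/cid; have [Mx|/Mmax [a Ma]] := pselect (M x).
    by exists 0; rewrite scale0r subr0.
  have a0 : a != 0 by apply: contra_notN Mw => /eqP a0; move: Ma; rewrite a0 scale0r subr0.
  exists a^-1; have := subspaceZ (- a^-1) sM Ma.
  by rewrite scalerBr scaleNr scaleNr scalerA mulVf// scale1r opprK addrC.
have uniq x c d : M (x - c *: w) -> M (x - d *: w) -> c = d.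
  move=> Mc Md; apply/eqP; rewrite eq_sym -subr_eq0; apply: contra_notT Mw => dc0.
  have := sM.2 (-1) _ _ Md Mc.
  rewrite scaleN1r opprB subrKA -scalerBl => /(subspaceZ (d - c)^-1 sM).
  by rewrite scalerA mulVf// scale1r.
pose h x := projT1 (ex x).
have hM x : M (x - h x *: w) by exact: projT2 (ex x).
have hL : linear_for *%R h.
  move=> a x y; apply: uniq (hM _) _.
  rewrite scalerDl -scalerA opprD addrACA -scalerBr.
  exact: sM.2.
pose hS : {scalar V} := HB.pack h (GRing.isLinear.Build _ _ _ _ _ hL).
exists hS; split=> /= [|x /SM Mx].
- by apply: uniq (hM _) _; rewrite scale1r subrr; exact: sM.1.
- by apply: uniq (hM _) _; rewrite scale0r subr0.
Qed.

End separation.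

Section ell.
Context (R : realType) (p : \bar R) (p1 : (1 <= p)%E).
Implicit Types (u : nat -> R) (x y : ell p1).

(** The ell_p spaces are ideals in the lattice of all sequences, with a norm
    monotone in the absolute value: the sums, respectively suprema, defining
    the norms are compared term by term. *)
Lemma ell_dominated u x : (forall n, `|u n| <= `|x n|) ->
  exists2 y : ell p1, u = y :> (nat -> R) & ellnorm y <= ellnorm x.
Proof.
case: p p1 x => [r| |] q1 x ux; last by [].
- have r0 : 0 < r by rewrite -lte_fin (lt_le_trans _ q1).
  have le_sum : (\sum_(0 <= n <oo) (`|u n| `^ r)%:E <=
      \sum_(0 <= n <oo) (`|x n| `^ r)%:E)%E.
    apply: lee_nneseries => n _; rewrite lee_fin ?powR_ge0//.
    by apply: ge0_ler_powR; rewrite ?nnegrE// ltW.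
  have [y uy] : exists y : ell q1, u = y :> (nat -> R).
    apply/in_ellP; apply: le_lt_trans le_sum _.
    by apply/(in_ellP q1); exists x.
  exists y => //; rewrite -lee_fin !ellnormP -uy.
  apply: gt0_ler_poweR; rewrite ?in_itv/= ?leey ?andbT//.
  + by rewrite invr_ge0 ltW.
  + by apply: nneseries_ge0 => n _ _; rewrite lee_fin powR_ge0.
  + by apply: nneseries_ge0 => n _ _; rewrite lee_fin powR_ge0.
- have xn n : `|x n| <= ellnorm x.
    by rewrite -lee_fin ellnormyP; apply: ereal_sup_ubound; exists n.
  have [y uy] : exists y : ell q1, u = y :> (nat -> R).
    by apply/in_ellyP; exists (ellnorm x) => n; exact: le_trans (xn n).
  exists y => //; rewrite -lee_fin (ellnormyP y) -uy.
  by apply: ge_ereal_sup => _ [n _ <-]; rewrite lee_fin; exact: le_trans (xn n).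
Qed.

Lemma ell_geometric : exists x : ell p1, forall n, x n = (2 ^ n.+1)%:R^-1.
Proof.
pose u : nat -> R := fun n => (2 ^ n.+1)%:R^-1.
suff [x ux] : exists x : ell p1, u = x :> (nat -> R) by exists x => n; rewrite -ux.
have u1 n : 0 < u n <= 1.
  by rewrite invr_gt0 ltr0n expn_gt0/= invf_le1 ?ltr0n ?expn_gt0// ler1n expn_gt0.
case: p p1 => [r| |] q1; last by [].
- apply/in_ellP.
  (* as r >= 1, the r-th powers are dominated by the terms, of sum 1 *)
  apply: (@le_lt_trans _ _ 1%:E); last exact: ltry.
  apply: le_trans (epsilon_trick0 xpredT (@ler01 R)).
  apply: lee_nneseries => n _; rewrite lee_fin ?powR_ge0// div1r.
  have /andP[un0 un1] := u1 n.
  by rewrite (ger0_norm (ltW un0)) ge1r_powR.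
- apply/in_ellyP; exists 1 => n; have /andP[un0 un1] := u1 n.
  by rewrite (ger0_norm (ltW un0)).
Qed.

Lemma notin_suppP x n : (~` supp x) n <-> x n = 0.
Proof. by split=> [/negP/negPn/eqP|xn]; last by apply/negP/negPn/eqP. Qed.

Lemma subspace_null (U : set_system nat) : Filter U ->
  subspace [set x : ell p1 | U (~` supp x)].
Proof.
move=> FU; split=> [|a x y /= Ux Uy].
  by apply: filterS (@filterT _ U _) => n _; exact/notin_suppP.
apply: filterS2 Ux Uy => n /notin_suppP xn /notin_suppP yn; apply/notin_suppP.
by rewrite -[LHS]/(a * x n + y n) xn yn mulr0 addr0.
Qed.

(** Subtracting finitely many terms does not change the value at w, while the
    norm of the tails of w tends to 0. *)
Lemma unbounded_functional (h : {scalar ell p1}) (v w : ell p1) :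
  (forall n, v n = (2 ^ n.+1)%:R^-1) -> (forall n, w n = v n ^+ 2) ->
  h w = 1 -> (forall x, (\forall n \near \oo, (~` supp x) n) -> h x = 0) ->
  ~ bounded_functional h.
Proof.
move=> vE wE hw h0 [M hM].
have v0 n : 0 <= v n by rewrite vE invr_ge0.
have le_norm N : (2 ^ N.+1)%:R <= `|M| * ellnorm v.
  pose u n := if (N <= n)%N then (2 ^ N.+1)%:R * w n else 0.
  have [|x ux xv] := @ell_dominated u v.
    move=> n; rewrite /u; case: ifP => Nn; last by rewrite normr0.
    rewrite wE expr2 mulrA normrM ler_piMl//.
    rewrite ger0_norm; last by rewrite mulr_ge0.
    by rewrite vE ler_pdivrMr ?ltr0n ?expn_gt0// mul1r ler_nat leq_exp2l.
  have hx : h x = (2 ^ N.+1)%:R.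
    (* x and 2^(N+1) w differ by a finitely supported sequence *)
    have -> : x = (2 ^ N.+1)%:R *: w + (- (2 ^ N.+1)%:R *: w + x).
      by rewrite addrA -scalerDl subrr scale0r add0r.
    rewrite linearP/= hw mulr1 h0 ?addr0//=.
    exists N => // n /= Nn; apply/notin_suppP.
    rewrite -[LHS]/(- (2 ^ N.+1)%:R * w n + x n).
    by rewrite -ux /u Nn mulNr addNr.
  rewrite -hx; apply: le_trans (ler_norm _) _; apply: le_trans (hM x) _.
  apply: le_trans (ler_wpM2l (normr_ge0 M) xv).
  by rewrite ler_wpM2r ?ler_norm// fine_ge0// Lnorm_ge0.
have := le_norm (Num.truncn (`|M| * ellnorm v)).
apply/negP; rewrite -ltNge; apply: lt_trans (truncnS_gt _) _.
by rewrite ltr_nat ltn_expl.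
Qed.

End ell.

Theorem theorem2 (R : realType) (p : \bar R) (p1 : (1 <= p)%E) :
  exists h : {scalar (ell p1)},
    ~ bounded_functional h /\
    forall A : set (ell p1), disjoint_family A ->
      exists a0 : ell p1, forall a : ell p1, A a -> a <> a0 -> h a = 0.
Proof.
have [U [UU ooU]] := @ultraFilterLemma nat \oo _.
have [v vE] := ell_geometric p1.
have v0 n : 0 < v n by rewrite vE invr_gt0 ltr0n expn_gt0.
have v1 n : v n <= 1.
  by rewrite vE invf_le1 ?ltr0n ?expn_gt0// ler1n expn_gt0.
have [|w wE _] := @ell_dominated R p p1 (fun n => v n ^+ 2) v.
  by move=> n; rewrite normrX expr2 ler_piMl// ger0_norm ?v1// ltW.
have [|h [hw h0]] := separating_functional (@subspace_null _ _ p1 U _) (w := w).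
  move=> /= Uw; apply: (@filter_not_empty _ U); apply: filterS Uw => n.
  by move=> /notin_suppP; rewrite -wE; apply/eqP; rewrite expf_neq0// gt_eqF.
exists h; split.
  apply: (unbounded_functional vE _ hw) => [n|x x0]; first by rewrite -wE.
  by apply: h0; exact: ooU.
move=> A dA; have [[a0 [Aa0 ha0]]|nA] := pselect (exists a, A a /\ h a <> 0).
  exists a0 => a Aa aa0; apply: (h0) => /=.
  have [Ua|//] := in_ultra_setVsetC (supp a) UU.
  (* supp a0 is disjoint from supp a, so if U has supp a then h a0 = 0 *)
  case: ha0; apply: (h0) => /=; apply: filterS Ua => n an a0n.
  by apply: aa0; apply: dA => //; exists n.
by exists 0 => a Aa _; apply: contrapT => ha; apply: nA; exists a.
Qed.
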